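(* Let $E$ be a Banach space and $\mathcal U$ be a non-principal ultrafilter on $\mathbb N$. If $E$ is almost Fra\''iss\'e, then the ultrapower $E_{\mathcal U}$ is almost Fra\''iss\'e and ultrahomogeneous.
   Context: For Banach spaces $X,E$ and $\delta\ge 0$, a $\delta$-isometry from $X$ to $E$ is a linear map $T\colon X\to E$ with $\frac{1}{1+\delta}\|x\|\le\|Tx\|\le(1+\delta)\|x\|$ for all $x\in X$. $\mathrm{Emb}(X,E)$ (resp. $\mathrm{Emb}_\delta(X,E)$) is the set of linear isometries (resp. $\delta$-isometries) from $X$ into $E$; $\mathrm{Isom}(E)$ (resp. $\mathrm{Isom}_\varepsilon(E)$) is the set of surjective linear isometries (resp. surjective $\varepsilon$-isometries) of $E$ onto $E$. $\mathrm{Age}(E)$ is the set of finite-dimensional subspaces of $E$, and $\mathrm{Age}_k(E)$ the set of $k$-dimensional subspaces. $E$ is almost Fra\''iss\'e if for every $k\in\mathbb N$ and $\varepsilon>0$ there is $\delta>0$ such that for every $X\in\mathrm{Age}_k(E)$ and every $\phi\in\mathrm{Emb}_\delta(X,E)$ there is $T\in\mathrm{Isom}_\varepsilon(E)$ with $T|_X=\phi$. $E$ is ultrahomogeneous if for every $X\in\mathrm{Age}(E)$, every $\phi\in\mathrm{Emb}(X,E)$ extends to an element of $\mathrm{Isom}(E)$. $E_{\mathcal U}$ is the Banach space ultrapower of $E$ along $\mathcal U$ (bounded sequences in $E$ modulo those with $\lim_{\mathcal U}\|x_n\|=0$, with norm $\|[(x_n)]_{\mathcal U}\|=\lim_{\mathcal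 U}\|x_n\|$). *)

(* Defs.v *)
From HB Require Import structures.
From mathcomp Require Import all_boot all_order all_algebra.
From mathcomp Require Import generic_quotient ring_quotient complex.
From mathcomp Require Import all_classical all_reals all_analysis.

From mathcomp Require Import ring.

Set Implicit Arguments.
Unset Strict Implicit.
Unset Printing Implicit Defensive.

Import Order.TTheory GRing.Theory Num.Theory.
Import numFieldNormedType.Exports.

Local Open Scope classical_set_scope.
Local Open Scope ring_scope.

(* The scalar field of a Banach space is the real line R or the complex plane
   R[i]. In both cases the norm of a normedModType takes values in the scalar
   field itself; in R[i], x <= y means that y - x is a nonnegative real. *)
Variant scalar_kind := RealScalars | ComplexScalars.

Definition scalar_field (R : realType) (s : scalar_kind) : numFieldType :=
  match s with RealScalars => R | ComplexScalars => R[i] end.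

Lemma ultra_fmap (S T : Type) (f : S -> T) (U : set_system S) :
  UltraFilter U -> UltraFilter (f @ U).
Proof.
move=> UU; split; first exact: fmap_proper_filter.
move=> G GG sUG; rewrite eqEsubset; split=> // A GA.
have [//|UnA] := in_ultra_setVsetC (f @^-1` A) UU.
have /(filterI GA) : G (~` A) by exact: sUG.
by rewrite setICr => G0; case: (filter_not_empty G G0).
Qed.

Lemma ultra_bounded_cvg (R : realType) (s : scalar_kind) (T : Type)
    (U : set_system T) (f : T -> scalar_field R s) (M : scalar_field R s) :
  UltraFilter U -> (\forall t \near U, `|f t| <= M) -> cvg (f t @[t --> U]).
Proof.
move=> UU.
have real_case (g : T -> R) (N : R) :
    (\forall t \near U, `|g t| <= N) -> cvg (g t @[t --> U]).
  move=> gN; have := @segment_compact R (- N) N; rewrite compact_ultra.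
  move=> /(_ (g @ U) (ultra_fmap _ UU)) [|l [_ gl]].
    by apply: filterS gN => t; rewrite /= in_itv /= ler_norml.
  by apply/cvg_ex; exists l.
case: s f M => f M fM; first exact: real_case fM.
have ReIm (z : R[i]) :
    (`|complex.Re z|%:C <= `|z|)%C /\ (`|complex.Im z|%:C <= `|z|)%C.
  case: z => a b; rewrite normc_def !lecR /= -!sqrtr_sqr.
  by split; apply: ler_wsqrtr; rewrite (lerDl, lerDr) sqr_ge0.
have le_Re (x : R) (y : R[i]) : (x%:C <= y)%C -> x <= complex.Re y.
  by case: y => a b; rewrite lecE /= => /andP[].
have /cvg_ex[a fa] : cvg ((complex.Re (f t) : R) @[t --> U]).
  apply: (real_case _ (complex.Re M)); apply: filterS fM => t ftM.
  by apply/le_Re/(le_trans _ ftM); case: (ReIm (f t)).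
have /cvg_ex[b fb] : cvg ((complex.Im (f t) : R) @[t --> U]).
  apply: (real_case _ (complex.Re M)); apply: filterS fM => t ftM.
  by apply/le_Re/(le_trans _ ftM); case: (ReIm (f t)).
apply/cvg_ex; exists (a +i* b)%C.
apply/cvgrPdist_le => e e0.
have eE : e = ((complex.Re e)%:C)%C by rewrite RRe_real // gtr0_real.
have e2 : 0 < complex.Re e / 2 by rewrite divr_gt0 // -ltcR -eE.
have /cvgrPdist_le /(_ _ e2) fa2 := fa; have /cvgrPdist_le /(_ _ e2) fb2 := fb.
near=> t.
have -> : (a +i* b)%C - f t = ((a - complex.Re (f t))%:C
    + 'i%C * (b - complex.Im (f t))%:C)%C.
  by rewrite [LHS]complexE /=; case: (f t).
apply: le_trans (ler_normD _ _) _.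
have normi : `|('i%C : R[i])| = 1.
  by rewrite normc_def /= expr0n add0r expr1n sqrtr1.
have normC (x : R) : `|(x%:C)%C| = ((`|x|)%:C)%C.
  by rewrite normc_def /= expr0n addr0 sqrtr_sqr.
rewrite normrM normi mul1r !normC eE -rmorphD /= lecR [leRHS](splitr).
by apply: lerD; near: t.
Unshelve. all: by end_near. Qed.

Lemma cvg_le_numField (K : numFieldType) (T : Type) (F : set_system T)
    (FF : ProperFilter F) (f g : T -> K) (a b : K) :
  f t @[t --> F] --> a -> g t @[t --> F] --> b ->
  (\forall t \near F, f t <= g t) -> a <= b.
Proof.
move=> fa gb fg; rewrite -subr_ge0.
have gfba : g t - f t @[t --> F] --> b - a by exact: cvgB.
suff <- : `|b - a| = b - a by [].
apply: (@cvg_unique _ (@norm_hausdorff _ K) (g t - f t @[t --> F])) => //.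
apply: cvg_trans (cvg_norm gfba); apply: near_eq_cvg.
by apply: filterS fg => t fgt /=; rewrite ger0_norm // subr_ge0.
Qed.

Lemma scalar_exp_small (R : realType) (s : scalar_kind) (e : scalar_field R s) :
  0 < e -> exists k, 2^-1 ^+ k < e.
Proof.
have real_case (r : R) : 0 < r -> exists k, 2^-1 ^+ k < r.
  move=> r0; exists (Num.trunc r^-1).+1.
  rewrite exprVn invf_plt ?posrE ?exprn_gt0 //.
  apply: lt_le_trans (truncnS_gt _) _.
  by rewrite -natrX ler_nat ltnW // ltn_expl.
case: s e => e e0; first exact: real_case.
have eE : e = ((complex.Re e)%:C)%C by rewrite RRe_real // gtr0_real.
have [|k ke] := real_case (complex.Re e); first by rewrite -ltcR -eE.
exists k; rewrite eE.
have -> : (2^-1 : R[i]) = (2^-1)%:C%C by rewrite fmorphV rmorph_nat.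
by rewrite -rmorphXn ltcR.
Qed.

Section BoundedSequences.
Variables (K : numFieldType) (E : normedModType K).

Definition bounded_seq : {pred nat -> E} :=
  [pred x | `[< bounded_fun (x : nat -> E) >]].

Lemma bounded_seqP (x : nat -> E) :
  reflect (exists M : K, forall n, `|x n| <= M) (x \in bounded_seq).
Proof.
have natF : ProperFilter (globally [set: nat]).
  exact: (@globally_properfilter _ _ 0%N).
apply: (iffP (asboolP _)) => [xb|[M xM]].
  by have [M xM] := (ex_bound x).1 xb; exists M => n; exact: xM.
by apply/ex_bound; exists M => n _; exact: xM.
Qed.

Lemma bounded_seq_submod_closed : submod_closed bounded_seq.
Proof.
split=> [|a x y /bounded_seqP[M xM] /bounded_seqP[N yN]].
  by apply/bounded_seqP; exists 0 => n; rewrite normr0.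
apply/bounded_seqP; exists (`|a| * M + N) => n.
apply: le_trans (ler_normD _ _) _.
by rewrite lerD // normrZ ler_wpM2l.
Qed.

HB.instance Definition _ :=
  GRing.isSubmodClosed.Build K (nat -> E) bounded_seq bounded_seq_submod_closed.

Record linfty := Linfty { seq_of :> nat -> E; _ : seq_of \in bounded_seq }.

HB.instance Definition _ := [isSub of linfty for seq_of].
HB.instance Definition _ := [Choice of linfty by <:].
HB.instance Definition _ := [SubChoice_isSubLmodule of linfty by <:].

Lemma linfty_bounded (x : linfty) : exists M : K, forall n, `|x n| <= M.
Proof. by apply/bounded_seqP; case: x. Qed.

Lemma linftyDE (x y : linfty) n : (x + y) n = x n + y n. Proof. by []. Qed.
Lemma linftyNE (x : linfty) n : (- x) n = - x n. Proof. by []. Qed.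
Lemma linftyZE a (x : linfty) n : (a *: x) n = a *: x n. Proof. by []. Qed.
Lemma linfty0E n : (0 : linfty) n = 0. Proof. by []. Qed.

End BoundedSequences.
Arguments bounded_seq {K} E.

Section Ultrapower.
Variables (R : realType) (s : scalar_kind).
Variables (E : normedModType (scalar_field R s)).
Variables (U : set_system nat) (UU : UltraFilter U).
Local Notation K := (scalar_field R s).

Lemma linfty_norm_cvg (x : linfty E) : cvg (`|x n| @[n --> U]).
Proof.
have [M xM] := linfty_bounded x.
apply: (@ultra_bounded_cvg R s _ U _ M) => //.
by near=> n; rewrite normr_id.
Unshelve. all: by end_near. Qed.

Definition ulim_norm (x : linfty E) : K := lim (`|x n| @[n --> U]).

Lemma ulim_norm_cvg (x : linfty E) : `|x n| @[n --> U] --> ulim_norm x.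
Proof. exact: linfty_norm_cvg. Qed.

Lemma ulim_normE (x : linfty E) (l : K) :
  `|x n| @[n --> U] --> l -> ulim_norm x = l.
Proof. by move=> xl; apply: cvg_lim. Qed.

Lemma ulim_norm0 : ulim_norm 0 = 0.
Proof.
by apply: ulim_normE; under eq_fun do rewrite linfty0E normr0; exact: cvg_cst.
Qed.

Lemma ulim_normZ a (x : linfty E) : ulim_norm (a *: x) = `|a| * ulim_norm x.
Proof.
apply: ulim_normE; under eq_fun do rewrite linftyZE normrZ.
by apply: cvgM; [exact: cvg_cst|exact: ulim_norm_cvg].
Qed.

Lemma ulim_norm_le (x y z : linfty E) :
  (\forall n \near U, `|x n| <= `|y n| + `|z n|) ->
  ulim_norm x <= ulim_norm y + ulim_norm z.
Proof.
apply: (@cvg_le_numField K nat U _ (fun n => `|x n|)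
  (fun n => `|y n| + `|z n|)); first exact: ulim_norm_cvg.
by apply: cvgD; exact: ulim_norm_cvg.
Qed.

Lemma ulim_normD (x y : linfty E) :
  ulim_norm (x + y) <= ulim_norm x + ulim_norm y.
Proof. by apply: ulim_norm_le; near=> n; exact: ler_normD.
Unshelve. all: by end_near. Qed.

Lemma ulim_normN (x : linfty E) : ulim_norm (- x) = ulim_norm x.
Proof. by rewrite -scaleN1r ulim_normZ normrN1 mul1r. Qed.

Lemma ulim_norm_ge0 (x : linfty E) : 0 <= ulim_norm x.
Proof.
apply: (@cvg_le_numField K nat U _ (fun=> 0) (fun n => `|x n|)).
- exact: cvg_cst.
- exact: ulim_norm_cvg.
- by near=> n; exact: normr_ge0.
Unshelve. all: by end_near. Qed.

Lemma ulim_norm_bound (x : linfty E) (c : K) :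
  (\forall n \near U, `|x n| <= c) -> ulim_norm x <= c.
Proof.
apply: (@cvg_le_numField K nat U _ (fun n => `|x n|) (fun=> c)).
  exact: ulim_norm_cvg.
exact: cvg_cst.
Qed.

Definition null_seq : {pred linfty E} := [pred x | ulim_norm x == 0].

Lemma null_seq_zmod_closed : zmod_closed null_seq.
Proof.
split=> [|x y]; rewrite !inE ?ulim_norm0 // => /eqP x0 /eqP y0.
rewrite eq_le ulim_norm_ge0 andbT (le_trans (ulim_normD _ _)) //.
by rewrite ulim_normN x0 y0 addr0.
Qed.

HB.instance Definition _ :=
  GRing.isZmodClosed.Build (linfty E) null_seq null_seq_zmod_closed.

(* The norm of the class of x is lim_U `|x n|, see norm_uclass; the linear
   structure makes uclass linear, see uclassD and uclassZ. *)
Definition ultrapower := Quotient.quot null_seq.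

HB.instance Definition _ := GRing.Zmodule.on ultrapower.

Definition uclass (x : linfty E) : ultrapower := \pi_ultrapower%qT x.

Lemma uclass_eqP (x y : linfty E) :
  uclass x = uclass y <-> ulim_norm (x - y) = 0.
Proof.
split=> [/eqP|xy]; last apply/eqP.
  by rewrite /uclass -Quotient.idealrBE inE => /eqP.
by rewrite /uclass -Quotient.idealrBE inE xy.
Qed.

Lemma uclass_surj (q : ultrapower) : exists x, uclass x = q.
Proof. by exists (repr q); exact: reprK. Qed.

Lemma uclassD (x y : linfty E) : uclass (x + y) = uclass x + uclass y.
Proof. exact: raddfD. Qed.

Lemma uclassN (x : linfty E) : uclass (- x) = - uclass x.
Proof. exact: raddfN. Qed.

Definition uscale (a : K) (q : ultrapower) : ultrapower := uclass (a *: repr q).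

Lemma uclassZ_subproof a (x : linfty E) : uscale a (uclass x) = uclass (a *: x).
Proof.
apply/uclass_eqP; rewrite -scalerBr ulim_normZ.
by rewrite (uclass_eqP _ _).1 ?mulr0 //; exact: reprK.
Qed.

Lemma uscaleA a b q : uscale a (uscale b q) = uscale (a * b) q.
Proof.
by have [x <-] := uclass_surj q; rewrite !uclassZ_subproof scalerA.
Qed.

Lemma uscale1 : left_id 1 uscale.
Proof.
by move=> q; have [x <-] := uclass_surj q; rewrite !uclassZ_subproof scale1r.
Qed.

Lemma uscaleDr : right_distributive uscale +%R.
Proof.
move=> a p q; have [x <-] := uclass_surj p; have [y <-] := uclass_surj q.
by rewrite -uclassD !uclassZ_subproof scalerDr uclassD.
Qed.

Lemma uscaleDl q : {morph uscale^~ q : a b / a + b}.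
Proof.
move=> a b; have [x <-] := uclass_surj q.
by rewrite !uclassZ_subproof scalerDl uclassD.
Qed.

HB.instance Definition _ :=
  GRing.Zmodule_isLmodule.Build K ultrapower uscaleA uscale1 uscaleDr uscaleDl.

Lemma uclassZ a (x : linfty E) : uclass (a *: x) = a *: uclass x.
Proof. by rewrite -uclassZ_subproof. Qed.

Lemma uclass0 : uclass 0 = 0.
Proof. exact: raddf0. Qed.

Definition unorm (q : ultrapower) : K := ulim_norm (repr q).

Lemma unorm_uclass (x : linfty E) : unorm (uclass x) = ulim_norm x.
Proof.
have le_uclass (y z : linfty E) :
    uclass y = uclass z -> ulim_norm y <= ulim_norm z.
  move=> /uclass_eqP yz; rewrite -[y](subrK z).
  by rewrite (le_trans (ulim_normD _ _)) // yz add0r.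
have reprE : uclass (repr (uclass x)) = uclass x by exact: reprK.
by apply/eqP; rewrite eq_le !le_uclass.
Qed.

Lemma unormD p q : unorm (p + q) <= unorm p + unorm q.
Proof.
have [x <-] := uclass_surj p; have [y <-] := uclass_surj q.
by rewrite -uclassD !unorm_uclass ulim_normD.
Qed.

Lemma unormZ a q : unorm (a *: q) = `|a| * unorm q.
Proof.
by have [x <-] := uclass_surj q; rewrite -uclassZ !unorm_uclass ulim_normZ.
Qed.

Lemma unorm0_eq0 q : unorm q = 0 -> q = 0.
Proof.
have [x <-] := uclass_surj q; rewrite unorm_uclass -uclass0 => x0.
by apply/uclass_eqP; rewrite subr0.
Qed.

HB.instance Definition _ :=
  Lmodule_isNormed.Build K ultrapower unormD unormZ unorm0_eq0.

Lemma norm_uclass (x : linfty E) : `|uclass x| = lim (`|x n| @[n --> U]).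
Proof. exact: unorm_uclass. Qed.

End Ultrapower.

Section UltrapowerComplete.
Variables (R : realType) (s : scalar_kind).
Variables (E : completeNormedModType (scalar_field R s)).
Variables (U : set_system nat) (UU : UltraFilter U).
Local Notation K := (scalar_field R s).
Local Notation EU := (ultrapower E UU).

Lemma uclass_lift (q : EU) (c : K) : `|q| < c ->
  exists x, uclass UU x = q /\ forall n, `|x n| <= c.
Proof.
move=> qc; have c0 : 0 <= c := le_trans (normr_ge0 q) (ltW qc).
have [x xq] := uclass_surj q.
pose y n : E := if `|x n| <= c then x n else 0.
have yc n : `|y n| <= c by rewrite /y; case: ifP => // _; rewrite normr0.
have yb : y \in bounded_seq E by apply/bounded_seqP; exists c.
exists (Linfty yb); split=> //; rewrite -xq; apply/uclass_eqP/eqP.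
rewrite eq_le ulim_norm_ge0 andbT ulim_norm_bound //.
have cq : 0 < c - `|q| by rewrite subr_gt0.
have xcvg : `|x n| @[n --> U] --> `|q|.
  by rewrite -xq norm_uclass; exact: linfty_norm_cvg.
have /cvgrPdist_le /(_ _ cq) := xcvg; apply: filterS => n xn.
rewrite linftyDE linftyNE /= /y ifT; first by rewrite subrr normr0.
have := ler_normD (`|x n| - `|q|) (`|q|); rewrite subrK !normr_id => /le_trans.
by apply; rewrite -lerBrDr distrC.
Qed.

Lemma ultrapower_complete (F : set_system EU) :
  ProperFilter F -> cauchy F -> cvg F.
Proof.
move=> FF Fc; pose c k : K := 2^-1 ^+ k.
have c0 k : 0 < c k by rewrite exprn_gt0 // invr_gt0.
have cS k : c k = c k.+1 + c k.+1.
  by rewrite /c exprS; field.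
have /choice[q qF] : forall k, exists q, F (ball q (c k)).
  by move=> k; have /cauchyP Fex := Fc; exact: Fex.
have qS k : `|q k.+1 - q k| < c k + c k.
  have [p [p1 p2]] := filter_ex (filterI (qF k.+1) (qF k)).
  rewrite -ball_normE /= in p1 p2.
  rewrite -(subrK p (q k.+1)) -addrA; apply: le_lt_trans (ler_normD _ _) _.
  rewrite (distrC p); apply: ltrD => //; apply: lt_trans p1 _.
  by rewrite [ltRHS]cS ltrDl.
have /choice[d dP] : forall k, exists x, uclass UU x = q k.+1 - q k /\
    forall n, `|x n| <= c k + c k by move=> k; exact: uclass_lift.
have [x0 x0q] := uclass_surj (q 0%N).
pose S k : linfty E := x0 + \sum_(i < k) d i.
have SS k : S k.+1 = S k + d k by rewrite /S big_ord_recr addrA.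
have Sq k : uclass UU (S k) = q k.
  elim: k => [|k IH]; first by rewrite /S big_ord0 addr0.
  by rewrite SS uclassD IH (dP k).1 addrC subrK.
have SB k m n : `|S (m + k)%N n - S k n| <= 4 * c k - 4 * c (m + k)%N.
  elim: m => [|m IH]; first by rewrite add0n !subrr normr0.
  rewrite addSn SS linftyDE addrAC; apply: le_trans (ler_normD _ _) _.
  apply: le_trans (lerD IH ((dP _).2 n)) _.
  rewrite -addrA lerD2l [in leLHS](cS (m + k)%N).
  by rewrite le_eqVlt; apply/orP; left; apply/eqP; ring.
have SB' k m n : `|S (m + k)%N n - S k n| <= 4 * c k.
  by apply: le_trans (SB k m n) _; rewrite gerBl mulr_ge0 // ltW.
have small (e : K) : 0 < e -> exists k, 5 * c k < e.
  move=> e0; have [|k ke] := @scalar_exp_small R s (e / 5).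
    by rewrite divr_gt0.
  by exists k; rewrite mulrC -ltr_pdivlMr.
have Scvg n : cvg (S k n @[k --> \oo]).
  apply: cauchy_cvg; apply: cauchy_exP => e /small[k ke]; exists (S k n).
  exists k => // m /= km; rewrite -ball_normE /= distrC -(subnK km).
  apply: le_lt_trans (SB' _ _ _) (le_lt_trans _ ke).
  by rewrite ler_pM2r ?ler_nat.
have /choice[z zP] : forall n, exists l : E,
    S k n @[k --> \oo] --> l.
  by move=> n; apply/cvg_ex; exact: Scvg.
have zS k n : `|z n - S k n| <= 4 * c k.
  apply: (@cvg_le_numField K nat \oo _ (fun m => `|S m n - S k n|)
    (fun=> 4 * c k)).
  - apply: cvg_norm; apply: cvgB; last exact: cvg_cst.
    exact: zP.
  - exact: cvg_cst.
  - by exists k => // m /= km; rewrite -(subnK km) SB'.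
have zb : z \in bounded_seq E.
  apply/bounded_seqP; have [M xM] := linfty_bounded (S 0%N).
  exists (4 * c 0%N + M) => n; rewrite -(subrK (S 0%N n) (z n)).
  by apply: le_trans (ler_normD _ _) _; exact: lerD.
pose Z := Linfty zb.
have Zq k : `|uclass UU Z - q k| <= 4 * c k.
  rewrite -Sq -uclassN -uclassD norm_uclass.
  apply: (@ulim_norm_bound R s E U UU); near=> n; exact: zS.
apply/cvg_ex; exists (uclass UU Z); apply/fcvgrPdist_lt => e /small[k ke].
apply: filterS (qF k) => p; rewrite -ball_normE /= => pk.
rewrite -(subrK (q k) (uclass UU Z)) -addrA.
apply: le_lt_trans (ler_normD _ _) _.
apply: lt_trans ke; have -> : 5 * c k = 4 * c k + c k by ring.
exact: ler_ltD.
Unshelve. all: by end_near. Qed.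

HB.instance Definition _ := Uniform_isComplete.Build EU ultrapower_complete.

End UltrapowerComplete.

Section FraisseProperties.
Variable K : numFieldType.

(* A map defined on a subspace X of E is encoded as a total function on E, of
   which only the values on X matter. The constants delta and eps live in K,
   like the values of the norm; being compared with 0, they are real. *)

Definition linear_on (E F : normedModType K) (X : set E) (f : E -> F) :=
  forall (a : K) (x y : E), X x -> X y -> f (a *: x + y) = a *: f x + f y.

Definition Emb (E F : normedModType K) (X : set E) : set (E -> F) :=
  [set f | linear_on X f /\ forall x, X x -> `|f x| = `|x|].

Definition Emb_delta (delta : K) (E F : normedModType K) (X : set E) :
    set (E -> F) :=
  [set f | linear_on X f /\
    forall x, X x -> (1 + delta)^-1 * `|x| <= `|f x| <= (1 + delta) * `|x|].

Definition Isom (E : normedModType K) : set (E -> E) :=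
  [set T | Emb setT T /\ range T = setT].

Definition Isom_eps (eps : K) (E : normedModType K) : set (E -> E) :=
  [set T | Emb_delta eps setT T /\ range T = setT].

Definition lin_comb (E : normedModType K) k (e : 'I_k -> E) (a : 'I_k -> K) :=
  \sum_i a i *: e i.

Definition lin_free (E : normedModType K) k (e : 'I_k -> E) :=
  forall a : 'I_k -> K, lin_comb e a = 0 -> forall i, a i = 0.

Definition Age_dim (k : nat) (E : normedModType K) : set (set E) :=
  [set X | exists2 e : 'I_k -> E, lin_free e & X = range (lin_comb e)].

Definition Age (E : normedModType K) : set (set E) :=
  [set X | exists k, Age_dim k X].

Definition almost_fraisse (E : completeNormedModType K) :=
  forall (k : nat) (eps : K), 0 < eps ->
  exists2 delta : K, 0 < delta &
    forall (X : set E) (phi : E -> E), Age_dim k X -> Emb_delta delta X phi ->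
    exists2 T : E -> E, Isom_eps eps T & forall x, X x -> T x = phi x.

Definition ultrahomogeneous (E : completeNormedModType K) :=
  forall (X : set E) (phi : E -> E), Age X -> Emb X phi ->
  exists2 T : E -> E, Isom T & forall x, X x -> T x = phi x.

End FraisseProperties.

(* Main.v *)
(* Let e be a basis of a finite-dimensional subspace X of the ultrapower, phi a
   delta-isometry on X, and lift e and phi(e) to tuples x(n), y(n) in E. For
   every delta' > delta and U-almost every n, x(n) is free and x(n) |-> y(n) is
   a delta'-isometry, so that it extends to some T_n in Isom_eps(E); the
   ultraproduct of the T_n extends phi. When phi is an isometry this works for
   every eps, and as U is not principal a diagonal choice of T_n yields an
   ultraproduct which lies in Isom_eps for every eps > 0. *)

Require Import Defs.
From mathcomp Require Import all_boot all_order all_algebra.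
From mathcomp Require Import all_classical all_reals all_analysis.

Set Implicit Arguments.
Unset Strict Implicit.
Unset Printing Implicit Defensive.

Import Order.TTheory GRing.Theory Num.Theory.
Import numFieldNormedType.Exports.

Local Open Scope classical_set_scope.
Local Open Scope ring_scope.

(** * Tails of the natural numbers in a non-principal ultrafilter *)

(** Singletons can be removed one at a time: if [U] contained [[set m]], it would be the principal
    filter at [m]. *)
Lemma ultra_nonprincipal_ge (U : set_system nat) (UU : UltraFilter U) :
  (forall n : nat, U <> principal_filter n) ->
  forall m, \forall n \near U, (m <= n)%N.
Proof.
move=> Unp; elim=> [|m IH]; first by near=> n.
suff Um : U (~` [set m]).
  apply: filterS (filterI IH Um) => n [mn nm].
  by rewrite ltn_neqAle mn andbT; apply/eqP => mn'; exact: nm.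
have [Um|//] := in_ultra_setVsetC [set m] UU.
case: (Unp m); rewrite predeqE => A; split=> [UA|].
  have [n [/= -> An]] := filter_ex (filterI Um UA).
  by apply/principal_filterP.
by move=> /principal_filterP Am; apply: filterS Um => n ->.
Unshelve. all: by end_near. Qed.

(** * Linear combinations and maps given on a basis *)

Section LinearMaps.
Variable K : numFieldType.

Lemma lin_comb_linear (E : normedModType K) k (e : 'I_k -> E) b
    (a c : 'I_k -> K) :
  lin_comb e (fun i => b * a i + c i) = b *: lin_comb e a + lin_comb e c.
Proof.
rewrite /lin_comb scaler_sumr -big_split; apply: eq_bigr => i _.
by rewrite scalerDl scalerA.
Qed.

Lemma lin_comb0 (E : normedModType K) k (e : 'I_k -> E) :
  lin_comb e (fun=> 0) = 0.
Proof. by rewrite /lin_comb big1 // => i _; rewrite scale0r. Qed.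

Lemma lin_combZ (E : normedModType K) k (e : 'I_k -> E) b (a : 'I_k -> K) :
  lin_comb e (fun i => b * a i) = b *: lin_comb e a.
Proof.
rewrite -[RHS]addr0 -(lin_comb0 e) -lin_comb_linear.
by congr lin_comb; apply: funext => i; rewrite addr0.
Qed.

Lemma lin_comb_delta (E : normedModType K) k (e : 'I_k -> E) i :
  lin_comb e (fun j => (j == i)%:R) = e i.
Proof.
rewrite /lin_comb (bigD1 i) //= eqxx scale1r big1 ?addr0 // => j /negPf ->.
by rewrite scale0r.
Qed.

Lemma lin_free_neq0 (E : normedModType K) k (e : 'I_k -> E) (a : 'I_k -> K) :
  lin_free e -> (exists i, a i != 0) -> 0 < `|lin_comb e a|.
Proof.
by move=> efree [i]; rewrite normr_gt0; apply: contra_neq => /efree.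
Qed.

(** As [linear_on] only speaks of vectors of [X], the induction over the sum also records that each
    partial sum stays in the span of [e]. *)
Lemma linear_on_lin_comb (E F : normedModType K) k (e : 'I_k -> E)
    (X : set E) (f : E -> F) (a : 'I_k -> K) :
  linear_on X f -> range (lin_comb e) `<=` X ->
  f (lin_comb e a) = lin_comb (f \o e) a.
Proof.
move=> flin eX.
have X0 : X 0 by apply: eX; exists (fun=> 0); rewrite ?lin_comb0.
have f0 : f 0 = 0 by have := flin (-1) 0 0 X0 X0; rewrite !scaleN1r !addNr.
suff [] : range (lin_comb e) (lin_comb e a) /\
  f (lin_comb e a) = lin_comb (f \o e) a by [].
rewrite {1 2 3 4}/lin_comb /=.
apply: (big_rec2 (fun z w => range (lin_comb e) z /\ f z = w)).
  by split=> //; exists (fun=> 0); rewrite ?lin_comb0.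
move=> i w z _ [[b _ bz] fz]; split.
  exists (fun j => a i * (j == i)%:R + b j) => //.
  by rewrite lin_comb_linear lin_comb_delta bz.
rewrite flin ?fz //; apply: eX; last by exists b.
by exists (fun j => (j == i)%:R); rewrite ?lin_comb_delta.
Qed.

(** Turns extension from subspaces into extension from tuples: the strict bounds force [x] to be
    free, so [x i] |-> [y i] defines a [delta]-isometry on its span. *)
Lemma almost_fraisse_tuple (E : completeNormedModType K) k (delta eps : K)
    (x y : 'I_k -> E) : 0 < delta ->
  (forall (X : set E) (phi : E -> E), Age_dim k X -> Emb_delta delta X phi ->
    exists2 T : E -> E, Isom_eps eps T & forall x, X x -> T x = phi x) ->
  (forall a, (exists i, a i != 0) ->
    `|lin_comb y a| < (1 + delta) * `|lin_comb x a|) ->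
  (forall a, (exists i, a i != 0) ->
    `|lin_comb x a| < (1 + delta) * `|lin_comb y a|) ->
  exists2 T : E -> E, Isom_eps eps T & forall i, T (x i) = y i.
Proof.
move=> d0 ext yx xy; have d1 : 0 < 1 + delta by rewrite addr_gt0.
have xfree : lin_free x.
  move=> a xa0 i; apply/eqP; apply: contraT => ai.
  have := yx a (ex_intro _ i ai).
  by rewrite xa0 normr0 mulr0 normr_lt0.
(* [g] reads off coordinates with respect to [x]; outside the span its value is an irrelevant 0. *)
have /choice[g gP] :
    forall v, exists a, range (lin_comb x) v -> lin_comb x a = v.
  move=> v; have [[a _ av]|nv] := pselect (range (lin_comb x) v).
    by exists a.
  by exists (fun=> 0).
have gx a : g (lin_comb x a) = a.
  have := gP (lin_comb x a) (ex_intro2 _ _ a I erefl).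
  move=> ga; apply: funext => i.
  have : lin_comb x (fun j => -1 * a j + g (lin_comb x a) j) = 0.
    by rewrite lin_comb_linear ga scaleN1r addNr.
  by move=> /xfree /(_ i); rewrite mulN1r addrC => /eqP; rewrite subr_eq0 => /eqP.
have [||T Tiso Tx] := ext (range (lin_comb x)) (fun v => lin_comb y (g v)).
- by exists x.
- split=> [b _ _ [u _ <-] [v _ <-]|_ [a _ <-]].
    by rewrite -lin_comb_linear !gx lin_comb_linear.
  rewrite gx; have [ai|/forallNP a0] := pselect (exists i, a i != 0).
    rewrite ler_pdivrMl // (ltW (yx a ai)) andbT.
    exact/ltW/xy.
  have -> : a = fun=> 0 by apply: funext => i; have /negP/negPn/eqP := a0 i.
  by rewrite !lin_comb0 !normr0 !mulr0 lexx.
exists T => // i.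
rewrite -[in LHS](lin_comb_delta x i) Tx.
  by rewrite gx lin_comb_delta.
by exists (fun j => (j == i)%:R).
Qed.

Lemma Emb_deltaW (E F : normedModType K) (X : set E) (c d : K) (f : E -> F) :
  0 < 1 + c -> c <= d -> Emb_delta c X f -> Emb_delta d X f.
Proof.
move=> c0 cd [flin fX]; split=> // v /fX /andP[lo hi].
have cd1 : 1 + c <= 1 + d by rewrite lerD2l.
have d0 : 0 < 1 + d := lt_le_trans c0 cd1.
rewrite (le_trans _ lo) ?(le_trans hi) ?ler_wpM2r //.
by rewrite lef_pV2.
Qed.

(** The identity is the default map at indices where no extension is available. *)
Lemma Isom_eps_id (E : normedModType K) (eps : K) :
  0 <= eps -> Isom_eps eps (@id E).
Proof.
move=> e0; split; last by rewrite predeqE => v; split=> // _; exists v.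
split=> // v _; have e1 : 0 < 1 + eps by exact: ltr_pwDl.
by rewrite ler_pdivrMl // !ler_peMl // lerDl.
Qed.

End LinearMaps.

(** * Ultralimits of linear combinations *)

Section UltrapowerMaps.
Variables (R : realType) (s : scalar_kind).
Variables (E : completeNormedModType (scalar_field R s)).
Variables (U : set_system nat) (UU : UltraFilter U).
Local Notation K := (scalar_field R s).
Local Notation EU := (ultrapower E UU).
Local Notation uclass := (uclass UU).

Lemma norm_uclass_cvg (x : linfty E) : `|x n| @[n --> U] --> `|uclass x|.
Proof. by rewrite norm_uclass; exact: linfty_norm_cvg. Qed.

Lemma linfty_sumE (I : finType) (x : I -> linfty E) n :
  (\sum_i x i) n = \sum_i x i n.
Proof. by apply: (big_morph (fun z : linfty E => z n)). Qed.

Lemma linfty_lift (x : nat -> E) (M : K) : (forall n, `|x n| <= M) ->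
  exists z : linfty E, forall n, z n = x n.
Proof.
move=> xM; have xb : x \in bounded_seq E by apply/bounded_seqP; exists M.
by exists (Linfty xb).
Qed.

Lemma uclass_eq_near (x y : linfty E) :
  (\forall n \near U, x n = y n) -> uclass x = uclass y.
Proof.
move=> xy; apply/uclass_eqP; apply/eqP; rewrite eq_le ulim_norm_ge0 andbT.
apply: ulim_norm_bound; apply: filterS xy => n xyn.
by rewrite linftyDE linftyNE xyn subrr normr0.
Qed.

(** With [M] a bound for [x], the difference [y n - l *: x n] has norm at most [|a n - l| * M],
    which tends to 0 along [U]. *)
Lemma uclass_scale_cvg (a : nat -> K) (l : K) (x y : linfty E) :
  a n @[n --> U] --> l -> (forall n, y n = a n *: x n) ->
  uclass y = l *: uclass x.
Proof.
move=> al yax; have [M xM] := linfty_bounded x.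
rewrite -uclassZ; apply/uclass_eqP; apply/eqP.
rewrite eq_le ulim_norm_ge0 andbT.
apply: (@cvg_le_numField K nat U _ (fun n => `|(y - l *: x) n|)
  (fun n => `|a n - l| * M)); first exact: ulim_norm_cvg.
  rewrite -[X in _ --> X](mul0r M); apply: cvgM; last exact: cvg_cst.
  rewrite -(@normr0 _ K) -(subrr l).
  by apply: cvg_norm; apply: cvgB => //; exact: cvg_cst.
near=> n; rewrite linftyDE linftyNE linftyZE yax -scalerBl normrZ.
exact: ler_wpM2l.
Unshelve. all: by end_near. Qed.

(** The bound [M] makes each [a n i *: x i n] a bounded sequence, so that it has a class in the
    ultrapower. *)
Lemma uclass_lin_comb_cvg k (a : nat -> 'I_k -> K) (l : 'I_k -> K)
    (x : 'I_k -> linfty E) (M : K) :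
  (forall n i, `|a n i| <= M) -> (forall i, a n i @[n --> U] --> l i) ->
  `|lin_comb (fun i => x i n) (a n)| @[n --> U] -->
    `|lin_comb (uclass \o x) l|.
Proof.
move=> aM al.
have /choice[z zP] : forall i, exists z : linfty E,
    forall n, z n = a n i *: x i n.
  move=> i; have [N xN] := linfty_bounded (x i).
  by apply: (@linfty_lift _ (M * N)) => n; rewrite normrZ ler_pM.
have -> : lin_comb (uclass \o x) l = uclass (\sum_i z i).
  rewrite (big_morph uclass (@uclassD _ _ _ _ UU) (@uclass0 _ _ _ _ UU)).
  by apply: eq_bigr => i _; rewrite -(uclass_scale_cvg (al i) (zP i)).
have -> : (fun n => `|lin_comb (fun i => x i n) (a n)|) =
    (fun n => `|(\sum_i z i : linfty E) n|).
  by apply: funext => n; rewrite linfty_sumE; congr `|_|; apply: eq_bigr.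
exact: norm_uclass_cvg.
Qed.

(* Replaces the compactness of the unit sphere of K^k: a normalised
   counterexample for each n would have an ultralimit, again normalised, at
   which the strict inequality fails in the ultrapower. *)
Lemma lin_comb_lt_near k (x y : 'I_k -> linfty E) (c : K) : 0 <= c ->
  (forall a, (exists i, a i != 0) ->
    `|lin_comb (uclass \o x) a| < c * `|lin_comb (uclass \o y) a|) ->
  \forall n \near U, forall a, (exists i, a i != 0) ->
    `|lin_comb (fun i => x i n) a| < c * `|lin_comb (fun i => y i n) a|.
Proof.
move=> c0 xy; pose B := [set n | forall a, (exists i, a i != 0) ->
  `|lin_comb (fun i => x i n) a| < c * `|lin_comb (fun i => y i n) a|].
rewrite -/(U B).
have [//|UB] := in_ultra_setVsetC B UU; exfalso.
(* Counterexamples are normalised in the l1 norm of the coefficients; at the indices of [B], a set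
   outside [U], the value 0 keeps [a] bounded. *)
have /choice[a aP] : forall n, exists a : 'I_k -> K,
    (forall i, `|a i| <= 1) /\ (~ B n -> \sum_i `|a i| = 1 /\
      c * `|lin_comb (fun i => y i n) a| <= `|lin_comb (fun i => x i n) a|).
  move=> n; have [Bn|] := pselect (B n).
    by exists (fun=> 0); split=> // i; rewrite normr0.
  move=> nB; have [b] := (existsNP _).2 nB.
  move=> /not_implyP[[i bi] nxy]; pose N := \sum_i `|b i|.
  have N0 : 0 < N.
    rewrite /N (bigD1 i) //= ltr_pwDl ?normr_gt0 // sumr_ge0 // => j _.
  have aN j : `|N^-1 * b j| = N^-1 * `|b j|.
    by rewrite normrM ger0_norm // invr_ge0 ltW.
  exists (fun j => N^-1 * b j); split=> [j|_].
    rewrite aN ler_pdivrMl // mulr1 /N (bigD1 j) //= lerDl sumr_ge0 //.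
  split.
    by under eq_bigr do rewrite aN; rewrite -mulr_sumr mulVf // gt_eqF.
  rewrite !lin_combZ !normrZ mulrCA ler_wpM2l //.
  (* The order of [K] need not be total, but both sides are nonnegative reals, so failure of [<]
     gives the reverse [<=]. *)
  rewrite real_leNgt ?realM ?ger0_real //.
  exact/negP.
have /choice[l al] : forall i, exists l : K, a n i @[n --> U] --> l.
  move=> i; apply/cvg_ex; apply: (@ultra_bounded_cvg R s _ U _ 1).
  by near=> n; exact: (aP n).1.
have lsum : \sum_i `|l i| = 1.
  have suml : \sum_i `|a n i| @[n --> U] --> \sum_i `|l i|.
    apply: cvg_big => [|i _]; first exact: add_continuous.
    by apply: cvg_norm; exact: al.
  apply: (@cvg_unique _ (@norm_hausdorff _ K)
    (\sum_i `|a n i| @[n --> U])) => //.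
  apply: cvg_near_cst; apply: filterS UB => n nBn.
  exact: ((aP n).2 nBn).1.
have ln0 : exists i, l i != 0.
  apply: contrapT => /forallNP l0; move: lsum; rewrite big1 => [/eqP|i _].
    by rewrite eq_sym oner_eq0.
  by have /negP/negPn/eqP -> := l0 i; rewrite normr0.
have aM n i := (aP n).1 i.
have := xy l ln0.
suff : c * `|lin_comb (uclass \o y) l| <= `|lin_comb (uclass \o x) l|.
  by move=> /le_lt_trans h /h; rewrite ltxx.
apply: (@cvg_le_numField K nat U _
  (fun n => c * `|lin_comb (fun i => y i n) (a n)|)
  (fun n => `|lin_comb (fun i => x i n) (a n)|)).
- by apply: cvgM; [exact: cvg_cst|exact: uclass_lin_comb_cvg].
- exact: uclass_lin_comb_cvg.
- by apply: filterS UB => n nBn; exact: ((aP n).2 nBn).2.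
Unshelve. all: by end_near. Qed.

(** * Ultraproducts of maps and the diagonal choice *)

(** The common [eps] keeps images and preimages of bounded sequences bounded, so the [T n] act
    coordinatewise; sharper constants [d] are only asked along [U], as the diagonal choice provides
    them. *)
Lemma ultraproduct_map (T : nat -> E -> E) (eps : K) : 0 <= eps ->
  (forall n, Isom_eps eps (T n)) ->
  exists S : EU -> EU, [/\ range S = setT,
    forall d, (\forall n \near U, Emb_delta d setT (T n)) ->
      Emb_delta d setT S &
    forall x y : linfty E, (\forall n \near U, T n (x n) = y n) ->
      S (uclass x) = uclass y].
Proof.
move=> e0 Tiso; have e1 : 0 < 1 + eps by exact: ltr_pwDl.
have Tlin n (b : K) u v : T n (b *: u + v) = b *: T n u + T n v.
  exact: (Tiso n).1.1.
have Thi n v : `|T n v| <= (1 + eps) * `|v|.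
  by have /andP[] := (Tiso n).1.2 v Logic.I.
have Tlo n v : `|v| <= (1 + eps) * `|T n v|.
  by have /andP[] := (Tiso n).1.2 v Logic.I; rewrite ler_pdivrMl.
have /choice[t tP] : forall x : linfty E, exists y : linfty E,
    forall n, y n = T n (x n).
  move=> x; have [M xM] := linfty_bounded x.
  apply: (@linfty_lift _ ((1 + eps) * M)) => n; apply: le_trans (Thi _ _) _.
  by rewrite ler_pM2l.
have tlin b x y : t (b *: x + y) = b *: t x + t y.
  apply: val_inj; apply: funext => n.
  by rewrite /= tP -[(b *: x + y) n]/(b *: x n + y n) Tlin -!tP.
have tle x : `|uclass (t x)| <= (1 + eps) * `|uclass x|.
  apply: (@cvg_le_numField K nat U _ (fun n => `|t x n|)
    (fun n => (1 + eps) * `|x n|)); first exact: norm_uclass_cvg.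
    by apply: cvgM; [exact: cvg_cst|exact: norm_uclass_cvg].
  by near=> n; rewrite tP.
pose S (q : EU) : EU := uclass (t (repr q)).
have SE x : S (uclass x) = uclass (t x).
  (* Independence of the representative: [tle] is applied to the null sequence [-1 *: x + z]. *)
  apply/eqP; rewrite -subr_eq0 -normr_le0 /S.
  set z := repr _; have zx : uclass z = uclass x by exact: reprK.
  have -> : uclass (t z) - uclass (t x) = uclass (t (-1 *: x + z)).
    by rewrite tlin scaleN1r addrC uclassD uclassN.
  apply: le_trans (tle _) _.
  by rewrite scaleN1r uclassD uclassN zx addNr normr0 mulr0.
exists S; split.
(* Preimages are taken coordinatewise; the lower bound [Tlo] makes them a bounded sequence. *)
- rewrite predeqE => q; split=> // _; have [y <-] := uclass_surj q.
  have /choice[x xP] : forall n, exists v, T n v = y n.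
    move=> n; have : range (T n) (y n) by rewrite (Tiso n).2.
    by move=> [v _ <-]; exists v.
  have [M yM] := linfty_bounded y.
  have [n|z zP] := @linfty_lift x ((1 + eps) * M).
    by apply: le_trans (Tlo n _) _; rewrite xP ler_pM2l.
  exists (uclass z) => //; rewrite SE; apply: uclass_eq_near.
  by near=> n; rewrite tP zP xP.
- move=> d Td; split=> [b p q _ _|q _].
    have [x <-] := uclass_surj p; have [y <-] := uclass_surj q.
    by rewrite -uclassZ -uclassD !SE tlin uclassD uclassZ.
  have [x <-] := uclass_surj q; rewrite SE; apply/andP; split.
    apply: (@cvg_le_numField K nat U _ (fun n => (1 + d)^-1 * `|x n|)
      (fun n => `|t x n|)); last 1 first.
    + by apply: filterS Td => n [_ /(_ (x n) Logic.I) /andP[]]; rewrite tP.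
    + by apply: cvgM; [exact: cvg_cst|exact: norm_uclass_cvg].
    + exact: norm_uclass_cvg.
  apply: (@cvg_le_numField K nat U _ (fun n => `|t x n|)
    (fun n => (1 + d) * `|x n|)); first exact: norm_uclass_cvg.
    by apply: cvgM; [exact: cvg_cst|exact: norm_uclass_cvg].
  by apply: filterS Td => n [_ /(_ (x n) Logic.I) /andP[]]; rewrite tP.
- move=> x y Txy; rewrite SE; apply: uclass_eq_near.
  by apply: filterS Txy => n; rewrite tP.
Unshelve. all: by end_near. Qed.

(* T n is chosen among the maps of the best quality c m available at n with
   m <= n; since U contains the sets [m, oo[, that quality improves along U. *)
Lemma diagonal_map k (x y : 'I_k -> linfty E) (c : nat -> K) :
  (forall m, \forall n \near U, (m <= n)%N) ->
  (forall m, 0 <= c m) -> (forall m n, (m <= n)%N -> c n <= c m) ->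
  (forall m, \forall n \near U, exists2 T : E -> E, Isom_eps (c m) T &
    forall i, T (x i n) = y i n) ->
  exists S : EU -> EU, [/\ range S = setT,
    forall m, Emb_delta (c m) setT S &
    forall i, S (uclass (x i)) = uclass (y i)].
Proof.
move=> Uge c0 cdec; pose P m n := exists2 T : E -> E, Isom_eps (c m) T &
  forall i, T (x i n) = y i n.
move=> PU.
have isoW m m' (T : E -> E) :
    (m <= m')%N -> Isom_eps (c m') T -> Isom_eps (c m) T.
  move=> mm' [Temb Tsurj]; split=> //; apply: Emb_deltaW Temb; last exact: cdec.
  exact: ltr_pwDl.
(* Induction on [N]: the largest available [m < N] wins, and by [isoW] its map also serves all
   smaller [m]. *)
have ex N n : exists T : E -> E, Isom_eps (c 0%N) T /\
    forall m, (m < N)%N -> P m n ->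
      Isom_eps (c m) T /\ forall i, T (x i n) = y i n.
  elim: N => [|N [T [T0 TN]]]; first by exists id; split=> //; exact: Isom_eps_id.
  have [[T' T'iso T'x]|nP] := pselect (P N n).
    exists T'; split=> [|m mN _]; first exact: isoW T'iso.
    by split=> //; exact: isoW T'iso.
  exists T; split=> // m; rewrite ltnS leq_eqVlt => /predU1P[->//|mN].
  exact: TN.
have /choice[T TP] : forall n, exists T : E -> E, Isom_eps (c 0%N) T /\
    forall m, (m <= n)%N -> P m n ->
      Isom_eps (c m) T /\ forall i, T (x i n) = y i n.
  by move=> n; have [T] := ex n.+1 n; exists T.
have [S [Ssurj Semb Sx]] := ultraproduct_map (c0 0%N) (fun n => (TP n).1).
exists S; split=> // [m|i].
  apply: Semb; apply: filterS (filterI (Uge m) (PU m)) => n [mn Pmn].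
  by have [[]] := (TP n).2 m mn Pmn.
apply: Sx; apply: filterS (PU 0%N) => n Pn.
exact: ((TP n).2 0%N (leq0n n) Pn).2.
Qed.

(** * Extending maps from finite-dimensional subspaces of the ultrapower *)

(** Half of the constant for [E] is used, since the slack between [delta / 2] and [delta] yields the
    strict inequalities that pass from the ultrapower to [U]-almost every coordinate. *)
Lemma almost_fraisse_near : almost_fraisse E -> forall (k : nat) (eps : K),
  0 < eps -> exists2 delta : K, 0 < delta &
    forall (x y : 'I_k -> linfty E) (X : set EU) (phi : EU -> EU),
    lin_free (uclass \o x) -> X = range (lin_comb (uclass \o x)) ->
    (forall i, phi (uclass (x i)) = uclass (y i)) ->
    Emb_delta delta X phi ->
    \forall n \near U, exists2 T : E -> E, Isom_eps eps T &
      forall i, T (x i n) = y i n.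
Proof.
move=> Efr k eps /(Efr k)[delta d0 ext].
have d2 : 0 < delta / 2 by rewrite divr_gt0.
have d21 : 0 < 1 + delta / 2 by rewrite addr_gt0.
have d1 : 0 < 1 + delta by rewrite addr_gt0.
have dd : 1 + delta / 2 < 1 + delta.
  by rewrite ltrD2l ltr_pdivrMr // ltr_pMr // ltr1n.
exists (delta / 2) => // x y X phi xfree XE phix [philin phile].
have phiE a : phi (lin_comb (uclass \o x) a) = lin_comb (uclass \o y) a.
  rewrite (linear_on_lin_comb _ philin) ?XE //.
  by apply: eq_bigr => i _; rewrite /= phix.
have bnd a : (exists i, a i != 0) ->
    0 < `|lin_comb (uclass \o x) a| /\
    `|lin_comb (uclass \o x) a| <=
      (1 + delta / 2) * `|lin_comb (uclass \o y) a| /\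
    `|lin_comb (uclass \o y) a| <=
      (1 + delta / 2) * `|lin_comb (uclass \o x) a|.
  move=> a0; split; first exact: lin_free_neq0.
  have /phile : X (lin_comb (uclass \o x) a) by rewrite XE; exists a.
  by rewrite phiE ler_pdivrMl // => /andP[].
have near1 : \forall n \near U, forall a, (exists i, a i != 0) ->
    `|lin_comb (fun i => x i n) a| <
      (1 + delta) * `|lin_comb (fun i => y i n) a|.
  apply: lin_comb_lt_near => [|a /bnd[x0 [xy yx]]]; first exact: ltW.
  apply: le_lt_trans (xy) _; rewrite ltr_pM2r //.
  (* The combination of the [y] is nonzero too, because it dominates that of the [x] up to a
     factor. *)
  by have := lt_le_trans x0 xy; rewrite pmulr_rgt0.
have near2 : \forall n \near U, forall a, (exists i, a i != 0) ->
    `|lin_comb (fun i => y i n) a| <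
      (1 + delta) * `|lin_comb (fun i => x i n) a|.
  apply: lin_comb_lt_near => [|a /bnd[x0 [xy yx]]]; first exact: ltW.
  by apply: le_lt_trans yx _; rewrite ltr_pM2r.
apply: filterS (filterI near1 near2) => n [n1 n2].
exact: (almost_fraisse_tuple d0 ext).
Qed.

(** Serves both conclusions: a constant [c] gives the almost Fraisse property, a null sequence [c]
    gives ultrahomogeneity. *)
Lemma ultrapower_extension (c : nat -> K) (k : nat) (X : set EU)
    (phi : EU -> EU) :
  (forall n : nat, U <> principal_filter n) ->
  (forall m, 0 <= c m) -> (forall m n, (m <= n)%N -> c n <= c m) ->
  Age_dim k X -> linear_on X phi ->
  (forall (x y : 'I_k -> linfty E),
    lin_free (uclass \o x) -> X = range (lin_comb (uclass \o x)) ->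
    (forall i, phi (uclass (x i)) = uclass (y i)) ->
    forall m, \forall n \near U, exists2 T : E -> E, Isom_eps (c m) T &
      forall i, T (x i n) = y i n) ->
  exists S : EU -> EU, [/\ range S = setT,
    forall m, Emb_delta (c m) setT S & forall v, X v -> S v = phi v].
Proof.
move=> Unp c0 cdec [e efree XE] philin ext.
have /choice[x xe] : forall i, exists x, uclass x = e i.
  by move=> i; exact: uclass_surj.
have xE : uclass \o x = e by exact: funext.
have /choice[y yP] : forall i, exists y, uclass y = phi (uclass (x i)).
  by move=> i; exact: uclass_surj.
rewrite -xE in efree XE.
have [S [Ssurj Semb Sx]] := diagonal_map (ultra_nonprincipal_ge UU Unp) c0 cdec
  (ext x y efree XE (fun i => esym (yP i))).
exists S; split=> // v; rewrite XE => -[a _ <-].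
(* [S] and [phi] are both linear on [X], so agreement on the basis suffices. *)
rewrite (linear_on_lin_comb a (Semb 0%N).1) //.
rewrite (linear_on_lin_comb a philin) ?XE //.
by apply: eq_bigr => i _; rewrite /= Sx yP.
Qed.

End UltrapowerMaps.

Theorem theorem4p26 (R : realType) (s : scalar_kind)
    (E : completeNormedModType (scalar_field R s))
    (U : set_system nat) (UU : UltraFilter U) :
  (forall n : nat, U <> principal_filter n) ->
  almost_fraisse E ->
  almost_fraisse (ultrapower E UU) /\ ultrahomogeneous (ultrapower E UU).
Proof.
move=> Unp Efr; split=> [k eps e0|X phi [k Xk] [philin phinorm]].
  have [delta d0 ext] := almost_fraisse_near UU Efr k e0.
  exists delta => // X phi Xk phiemb.
  have [|//|x y xfree XE phix _|S [Ssurj Semb SX]] :=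
    @ultrapower_extension _ _ _ _ UU (fun=> eps) k X phi Unp _ _ Xk phiemb.1.
  - by move=> _; exact: ltW.
  - exact: ext phiemb.
  - by exists S => //; split=> //; exact: Semb 0%N.
pose c m : scalar_field R s := 2^-1 ^+ m.
have c0 m : 0 < c m by rewrite exprn_gt0 // invr_gt0.
have [|m n mn|x y xfree XE phix m|S [Ssurj Semb SX]] :=
  @ultrapower_extension _ _ _ _ UU c k X phi Unp _ _ Xk philin.
- by move=> m; exact: ltW.
- by rewrite ler_wiXn2l // ?invr_ge0 // invf_le1 ?ler1n.
- have [delta d0 ext] := almost_fraisse_near UU Efr k (c0 m).
  (* An isometry is a [delta]-isometry whichever [delta] belongs to [c m]. *)
  apply: ext xfree XE phix _; split=> // v Xv.
  have d1 : 0 < 1 + delta by rewrite addr_gt0.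
  by rewrite phinorm // ler_pdivrMl // !ler_peMl // lerDl ltW.
exists S => //; split=> //; split=> [|v _]; first exact: (Semb 0%N).1.
(* Limit over [m]: if [q < p], the case [m = 0] excludes [q = 0], and then some [c m < p / q - 1]
   contradicts the bound. *)
have small (p q : scalar_field R s) : 0 <= p -> 0 <= q ->
    (forall m, p <= (1 + c m) * q) -> p <= q.
  move=> p0 q0 pq; rewrite real_leNgt ?ger0_real //; apply/negP => qp.
  have [q00|qpos] := eqVneq q 0.
    by have := pq 0%N; rewrite q00 mulr0 -q00 => /(lt_le_trans qp); rewrite ltxx.
  have q1 : 0 < q by rewrite lt_def qpos.
  have [|m] := @scalar_exp_small R s (p / q - 1).
    by rewrite subr_gt0 ltr_pdivlMr // mul1r.
  rewrite ltrBrDl ltr_pdivlMr // => /(le_lt_trans (pq m)).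
  by rewrite ltxx.
have S_bounds m := (Semb m).2 v Logic.I.
apply/le_anti/andP; split.
  all: apply: small => [||m]; [exact: normr_ge0|exact: normr_ge0|].
  by have /andP[] := S_bounds m.
have /andP[S_ge _] := S_bounds m; move: S_ge.
by rewrite ler_pdivrMl // addr_gt0.
Qed.
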